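(* Let $(\Omega,\Sigma,\mu)$ be a positive measure space, where $\Omega$ may be any set, and let $\mathbb{K}\in\{\mathbb{R},\mathbb{C}\}$. For each given $n$-dimensional subspace $V_n$ of $L_1(\Omega,\mu;\mathbb{K})$ with effective real dimension $N=\operatorname{eff-dim}_{\mathbb{R}}V_n$, there exist points $x_1,\ldots,x_N\in\Omega$ and associated non-negative weights $\mu_1,\ldots,\mu_N\ge 0$ such that $$\int_{\Omega} f(x)\,\mathrm{d}\mu(x)=\sum_{j=1}^{N}\mu_j f(x_j)\quad\text{for all } f\in V_n .$$
   Context: A positive measure is a measure in the classical sense, with values in $[0,\infty]$ (no finiteness or $\sigma$-finiteness assumed). $L_1(\Omega,\mu;\mathbb{K})$ is the space of $\mu$-integrable $\mathbb{K}$-valued functions. The space $V_n$ is assumed to consist of proper functions $\Omega\to\mathbb{K}$, whose values $f(x)$ are unambiguously defined for each $x\in\Omega$. (If $V_n$ is a priori a space of $\mu$-equivalence classes, one fixes representatives $\varphi_1,\ldots,\varphi_n$ of a basis and takes $V_n$ to be the space of functions that is their $\mathbb{K}$-linear span.) The effective real dimension is $\operatorname{eff-dim}_{\mathbb{R}}V_n:=\dim_{\mathbb{R}}\operatorname{Re}(V_n)$, where $\operatorname{Re}(V_n):=\{\operatorname{Re}\circ f: f\in V_n\}$ is regarded as a real vector space of functions $\Omega\to\mathbb{R}$. *)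

(* Defs.v *)
From HB Require Import structures.
From mathcomp Require Import all_boot all_order all_algebra.
From mathcomp Require Import all_classical all_reals all_analysis.
From mathcomp Require Import complex.

Set Implicit Arguments.
Unset Strict Implicit.
Unset Printing Implicit Defensive.

Import Order.TTheory GRing.Theory Num.Theory.

Local Open Scope classical_set_scope.
Local Open Scope ring_scope.

Definition has_dim (F : fieldType) (L : lmodType F) (V : set L) (n : nat) :=
  exists b : 'I_n -> L,
    (forall c : 'I_n -> F, \sum_i c i *: b i = 0 -> forall i, c i = 0) /\
    V = [set v | exists c : 'I_n -> F, v = \sum_i c i *: b i].

Variant scalars := RealScalars | ComplexScalars.

Definition scalar_field (R : realType) (k : scalars) : fieldType :=
  match k with
  | RealScalars => R
  | ComplexScalars => R[i]
  end.

Definition scalar_of_real (R : realType) (k : scalars) :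
    R -> scalar_field R k :=
  match k return R -> scalar_field R k with
  | RealScalars => id
  | ComplexScalars => fun a => a%:C%C
  end.

Definition scalar_Re (R : realType) (k : scalars) : scalar_field R k -> R :=
  match k return scalar_field R k -> R with
  | RealScalars => id
  | ComplexScalars => fun z => complex.Re z
  end.

(* Measurability of a complex function is that of its real and imaginary
   parts, i.e. measurability for the Borel sets of C = R x R. *)
Definition complex_integrable d (T : measurableType d) (R : realType)
    (mu : {measure set T -> \bar R}) (f : T -> R[i]) : Prop :=
  [/\ measurable_fun [set: T] (fun x => complex.Re (f x)),
      measurable_fun [set: T] (fun x => complex.Im (f x)) &
      (\int[mu]_x (ComplexField.Normc.normc (f x))%:E < +oo)%E].

Definition complex_integral d (T : measurableType d) (R : realType)
    (mu : {measure set T -> \bar R}) (f : T -> R[i]) : R[i] :=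
  ((\int[mu]_x complex.Re (f x)) +i* (\int[mu]_x complex.Im (f x)))%C.

(* L_1(T, mu; K), made of genuine functions rather than of classes modulo
   almost everywhere equality. *)
Definition L1fun d (T : measurableType d) (R : realType)
    (mu : {measure set T -> \bar R}) (k : scalars) :
    set (T -> scalar_field R k) :=
  match k return set (T -> scalar_field R k) with
  | RealScalars => [set f : T -> R | mu.-integrable [set: T] (EFin \o f)]
  | ComplexScalars => [set f : T -> R[i] | complex_integrable mu f]
  end.

Definition scalar_integral d (T : measurableType d) (R : realType)
    (mu : {measure set T -> \bar R}) (k : scalars) :
    (T -> scalar_field R k) -> scalar_field R k :=
  match k return (T -> scalar_field R k) -> scalar_field R k with
  | RealScalars => fun f : T -> R => \int[mu]_x f x
  | ComplexScalars => fun f => complex_integral mu f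
  end.

(* The regular module [F^o] makes [T -> F^o] a vector space over [F]; as a type
   it is [T -> F]. *)
Definition fun_dim (T : Type) (F : fieldType) (V : set (T -> F)) (n : nat) :=
  @has_dim F (T -> F^o) V n.

Definition Re_space (T : Type) (R : realType) (k : scalars)
    (V : set (T -> scalar_field R k)) : set (T -> R) :=
  [set (@scalar_Re R k \o f) | f in V].

Definition eff_dim (T : Type) (R : realType) (k : scalars)
    (V : set (T -> scalar_field R k)) (N : nat) :=
  fun_dim (Re_space V) N.

(* Main.v *)
Require Import Defs.
From mathcomp Require Import all_boot all_order all_algebra.
From mathcomp Require Import all_classical all_reals all_analysis.
From mathcomp Require Import complex measurable_realfun lra.

(** Let g_1, ..., g_N be a basis of Re(V) and let g : T -> R^N be the map with
    these coordinates.  A quadrature formula with non-negative weights that is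
    exact on Re(V) is a way of writing the vector I = (int g_1, ..., int g_N)
    as a non-negative combination of values of g, so the point is that I lies
    in the convex cone generated by g(T), which need not be closed.

    Suppose it does not.  In finite dimension a point outside a convex cone is
    weakly separated from it by a hyperplane, with no closedness assumption
    ([cone_separation]): there is c != 0 with <c, g> >= 0 everywhere and
    <c, I> <= 0.  As <c, I> is the integral of <c, g>, the function <c, g>
    vanishes almost everywhere.  Hence, on a conull set D, the map g takes its
    values in the hyperplane orthogonal to c, which also contains I, and the
    claim for g on D is a claim in one dimension less.
    [row_integral_conic_hull] is this induction on the dimension; it is stated
    for the cone generated by g(D), where D is any conull set, so that shrinking
    D costs nothing, and integrals are always taken over the whole space.

    The conic version of Caratheodory's theorem ([conic_caratheodory]) brings
    the number of nodes down to N.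

    If the scalars are complex, the formula holds for Re f by construction, and
    for Im f because Im f = Re (- i f) and V is stable under multiplication by
    - i; so the same nodes and weights serve for f. *)

Import Order.TTheory GRing.Theory Num.Theory.
Local Open Scope classical_set_scope.
Local Open Scope ring_scope.

(** * Weak separation from a convex cone *)

Definition convex_cone {R : realType} {m : nat} (K : set 'rV[R]_m) :=
  [/\ K 0, forall u v, K u -> K v -> K (u + v) &
      forall a u, 0 <= a -> K u -> K (a *: u)].

(** No closedness is assumed, so instead of projecting onto the cone one
    eliminates the first coordinate, as in Fourier-Motzkin elimination.  If the
    first coordinate has constant sign on K, then it is, up to sign, the
    functional sought.  Otherwise K has points on both sides of the hyperplane
    where that coordinate is 0, and the slice of K by this hyperplane is again
    proper, since together with the points on both sides a full slice would
    generate the whole space.  A functional c that is non-negative on the slice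
    extends to K: the conditions on the missing coefficient c0 are lower bounds
    coming from one side and upper bounds coming from the other, and adding a
    point of each side gives a point of the slice, which says that every lower
    bound is below every upper bound. *)
Lemma proper_cone_dual {R : realType} {m : nat} (K : set 'rV[R]_m) :
  convex_cone K -> (exists q, ~ K q) ->
  exists2 c : 'cV[R]_m, c != 0 & forall v, K v -> 0 <= (v *m c) 0 0.
Proof.
elim: m K => [|m IHm] K [K0 KD KZ] [q nKq].
  by case: nKq; rewrite thinmx0.
pose cons (a : R) (v : 'rV[R]_m) : 'rV[R]_m.+1 := row_mx (a%:M : 'M[R]_1) v.
have consD a v b w : cons a v + cons b w = cons (a + b) (v + w).
  by rewrite /cons (@add_row_mx _ 1 1 m) raddfD.
have consZ a b v : a *: cons b v = cons (a * b) (a *: v).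
  by rewrite /cons (@scale_row_mx _ 1 1 m) scale_scalar_mx.
have consE (u : 'rV[R]_m.+1) : exists a v, u = cons a v.
  exists ((@lsubmx _ 1 1 m u) 0 0), (@rsubmx _ 1 1 m u).
  by rewrite /cons -mx11_scalar hsubmxK.
have consM a v c0 (c : 'cV[R]_m) :
    (cons a v *m (col_mx (c0%:M : 'M[R]_1) c : 'cV[R]_m.+1)) 0 0
    = a * c0 + (v *m c) 0 0.
  rewrite /cons (@mul_row_col _ 1 1 m 1) mul_scalar_mx scale_scalar_mx.
  by rewrite !mxE mulr1n.
have col1_neq0 (c0 : R) : c0 != 0 ->
    (col_mx (c0%:M : 'M[R]_1) 0 : 'cV[R]_m.+1) != 0.
  apply: contra_neq => /(congr1 (fun z : 'cV[R]_m.+1 => (cons 1 0 *m z) 0 0)).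
  by rewrite consM mul1r mulmx0 mxE mulmx0 mxE addr0.
have [[b [w [b0 Kw]]]|Kge0] := pselect (exists b w, b < 0 /\ K (cons b w));
  last first.
  exists (col_mx (1%:M : 'M[R]_1) 0); first exact/col1_neq0/oner_neq0.
  move=> u; have [a [v ->]] := consE u => Kv.
  rewrite consM mulr1 mulmx0 mxE addr0 leNgt; apply/negP => a0.
  by apply: Kge0; exists a, v.
have [[a [v [a0 Kv]]]|Kle0] := pselect (exists a v, 0 < a /\ K (cons a v));
  last first.
  exists (col_mx ((-1)%:M : 'M[R]_1) 0).
    by apply: col1_neq0; rewrite oppr_eq0 oner_neq0.
  move=> u; have [a [v ->]] := consE u => Kv.
  rewrite consM mulrN1 mulmx0 mxE addr0 oppr_ge0 leNgt; apply/negP => a0.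
  by apply: Kle0; exists a, v.
have [//||c c_neq0 cP] := IHm [set z | K (cons 0 z)].
- split=> [|y z|e z e0] /=.
  + by rewrite /cons raddf0 (@row_mx0 _ 1 1 m).
  + by move=> Ky Kz; have := KD _ _ Ky Kz; rewrite consD addr0.
  + by move=> Kz; have := KZ _ _ e0 Kz; rewrite consZ mulr0.
- apply: contra_notP nKq => /forallNP slice.
  have {}slice z : K (cons 0 z) by apply: contrapT; exact: slice.
  have [e [z ->]] := consE q.
  have split_off d y : d != 0 -> 0 <= e / d -> K (cons d y) -> K (cons e z).
    move=> d0 ed0 Ky; have := KD _ _ (KZ _ _ ed0 Ky) (slice (z - (e / d) *: y)).
    by rewrite consZ consD addr0 divfK// addrC subrK.
  (* Reach first coordinate e from the side that has its sign. *)
  have [e0|/ltW e0] := leP 0 e.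
    by apply: (split_off a v) => //; [rewrite gt_eqF|rewrite divr_ge0// ltW].
  apply: (split_off b w) => //; first by rewrite lt_eqF.
  by rewrite -[e / b]mulrNN -invrN divr_ge0 ?oppr_ge0// ltW.
(* Up to scaling, only the points with first coordinate 1 or -1 matter. *)
have normalize e z : e != 0 -> K (cons e z) ->
    K (cons (Num.sg e) (`|e|^-1 *: z)).
  move=> e0 Kz; have := KZ `|e|^-1 _ _ Kz.
  rewrite consZ invr_ge0 normr_ge0 => /(_ isT).
  by rewrite {2}[e]numEsg mulrCA mulVf ?normr_eq0// mulr1.
(* S is the set of lower bounds on the missing coefficient. *)
pose S := [set - (z *m c) 0 0 | z in [set z | K (cons 1 z)]].
have Sv : S (- (a^-1 *: v *m c) 0 0).
  by exists (a^-1 *: v) => //=; have := normalize _ _ (lt0r_neq0 a0) Kv;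
    rewrite gtr0_sg// gtr0_norm.
have ubS z : K (cons (-1) z) -> ubound S ((z *m c) 0 0).
  move=> Kz _ [y /= Ky <-]; rewrite lerNl -subr_ge0 opprK.
  have := KD _ _ Ky Kz; rewrite consD subrr => /cP.
  by rewrite mulmxDl mxE.
have Kw1 : K (cons (-1) (`|b|^-1 *: w)).
  by have := normalize _ _ (ltr0_neq0 b0) Kw; rewrite ltr0_sg.
have supS : has_sup S by split; [eexists; exact: Sv|eexists; exact: ubS Kw1].
exists (col_mx ((sup S)%:M : 'M[R]_1) c).
  apply: contra_neq c_neq0 => cc0; apply/colP => i.
  have := congr1 (fun z : 'cV[R]_(1 + m) => z (rshift 1 i) 0) cc0.
  by rewrite (@col_mxEd _ 1 m 1) !mxE.
move=> u; have [e [z ->]] := consE u => Kz; rewrite consM.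
have [e0|e0|e0] := ltgtP e 0; last by rewrite e0 mul0r add0r cP// -e0.
- have := normalize _ _ (ltr0_neq0 e0) Kz.
  rewrite ltr0_sg// ltr0_norm// => /ubS/ge_sup-/(_ supS.1).
  rewrite -scalemxAl mxE mulrC ler_pdivlMr ?oppr_gt0//; lra.
- have := normalize _ _ (lt0r_neq0 e0) Kz.
  rewrite gtr0_sg// gtr0_norm// => K1.
  have := ub_le_sup supS.2 (imageP (fun z => - (z *m c) 0 0) K1).
  by rewrite -scalemxAl mxE lerNl mulrC ler_pdivlMr//; lra.
Qed.

(** The cone K - R_+ p omits p: if p = v - a p with v in K and a >= 0, then
    p = v / (1 + a) is in K.  A functional that is non-negative on this proper
    cone is non-negative on K and non-positive at p. *)
Lemma cone_separation {R : realType} {m : nat} (K : set 'rV[R]_m) p :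
  convex_cone K -> ~ K p ->
  exists c : 'cV[R]_m,
    [/\ c != 0, forall v, K v -> 0 <= (v *m c) 0 0 & (p *m c) 0 0 <= 0].
Proof.
move=> [K0 KD KZ] nKp.
pose K' := [set v | exists2 a, 0 <= a & K (v + a *: p)].
have coneK' : convex_cone K'.
  split=> [|u v [a a0 Ku] [b b0 Kv]|e u e0 [a a0 Ku]].
  - by exists 0; rewrite // scale0r addr0.
  - exists (a + b); first exact: addr_ge0.
    by rewrite scalerDl addrACA; exact: KD.
  - exists (e * a); first exact: mulr_ge0.
    by rewrite -scalerA -scalerDr; exact: KZ.
have [|c c0 cP] := proper_cone_dual K' coneK'.
  exists p => -[a a0]; rewrite -[X in X + _]scale1r -scalerDl => Kp.
  have a1 : 0 < 1 + a by rewrite ltr_pwDl.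
  apply: nKp; have := KZ (1 + a)^-1 _ _ Kp.
  by rewrite scalerA mulVf ?gt_eqF// scale1r invr_ge0 ltW//; apply.
exists c; split=> // [v Kv|]; first by apply: cP; exists 0;
  rewrite // scale0r addr0.
rewrite -oppr_ge0; have := cP (- p); rewrite mulNmx mxE; apply.
by exists 1; rewrite ?ler01// scale1r addNr.
Qed.

(** * Conic hulls and Caratheodory's theorem *)

(** Adding generators one at a time makes Caratheodory's theorem an induction
    whose only step replaces m + 1 generators by m of them. *)
Inductive conic_hull {R : realType} {m : nat} (S : set 'rV[R]_m) :
    'rV[R]_m -> Prop :=
| conic_hull0 : conic_hull S 0
| conic_hullD a s v : 0 <= a -> S s -> conic_hull S v ->
    conic_hull S (a *: s + v).

Lemma convex_cone_hull {R : realType} {m : nat} (S : set 'rV[R]_m) :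
  convex_cone (conic_hull S).
Proof.
split=> [|u v|e u e0]; first exact: conic_hull0.
- by elim=> [|a s w a0 Ss _ IH] Sv; rewrite ?add0r// -addrA;
    apply: conic_hullD => //; exact: IH.
- elim=> [|a s w a0 Ss _ IH]; first by rewrite scaler0; exact: conic_hull0.
  by rewrite scalerDr scalerA; apply: conic_hullD => //; exact: mulr_ge0.
Qed.

Lemma sub_conic_hull {R : realType} {m : nat} (S : set 'rV[R]_m) :
  S `<=` conic_hull S.
Proof.
move=> s Ss; rewrite -[s]addr0 -[s]scale1r.
exact: conic_hullD (conic_hull0 S).
Qed.

Lemma conic_hull_mulmx {R : realType} {m p : nat} (B : 'M[R]_(m, p)) S S' :
  (forall s, S s -> S' (s *m B)) ->
  forall u, conic_hull S u -> conic_hull S' (u *m B).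
Proof.
move=> SS' u; elim=> [|a s v a0 Ss _ IH].
  by rewrite mul0mx; exact: conic_hull0.
by rewrite mulmxDl -scalemxAl; apply: conic_hullD => //; exact: SS'.
Qed.

(** The m + 1 vectors satisfy a linear relation with coefficients l, some of
    which are positive after a change of sign.  Subtracting the multiple
    w_i / l_i of this relation, where i minimises that ratio among the indices
    with l_i > 0, keeps all weights non-negative and kills the i-th one. *)
Lemma conic_exchange {R : realType} {m : nat} (w : 'I_m.+1 -> R)
    (s : 'I_m.+1 -> 'rV[R]_m) :
  (forall j, 0 <= w j) ->
  exists (i : 'I_m.+1) (w' : 'I_m -> R), (forall j, 0 <= w' j) /\
    \sum_j w j *: s j = \sum_j w' j *: s (lift i j).
Proof.
move=> w0; pose M := \matrix_j s j.
have [l [i0 li0] lM] : exists2 l : 'rV[R]_m.+1, (exists i, 0 < l 0 i) & l *m M = 0.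
  have : kermx M != 0.
    by rewrite kermx_eq0 /row_free ltn_eqF// ltnS rank_leq_col.
  case/rowV0Pn => l /sub_kermxP lM.
  case/rV0Pn => i; rewrite neq_lt => /orP[li|li]; last by exists l => //; exists i.
  exists (- l); last by rewrite mulNmx lM oppr0.
  by exists i; rewrite mxE oppr_gt0.
have [i li imin] :=
  @arg_minP _ _ _ i0 (fun j => 0 < l 0 j) (fun j => w j / l 0 j) li0.
exists i, (fun j => w (lift i j) - w i / l 0 i * l 0 (lift i j)); split.
  move=> j; rewrite subr_ge0; set k := lift i j.
  have [lk|lk] := leP (l 0 k) 0.
    by apply: le_trans (w0 k); rewrite mulr_ge0_le0// divr_ge0// ltW.
  by rewrite -ler_pdivlMr//; exact: imin.
have lMs : \sum_j l 0 j *: s j = 0.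
  by rewrite -[RHS]lM mulmx_sum_row; under [RHS]eq_bigr do rewrite rowK.
transitivity (\sum_j (w j - w i / l 0 i * l 0 j) *: s j).
  under [RHS]eq_bigr do rewrite scalerBl -scalerA.
  by rewrite sumrB -scaler_sumr lMs scaler0 subr0.
by rewrite (bigD1_ord i)//= divfK ?gt_eqF// subrr scale0r add0r.
Qed.

Lemma conic_caratheodory {R : realType} {m : nat} (S : set 'rV[R]_m) v :
  S !=set0 -> conic_hull S v ->
  exists (w : 'I_m -> R) (s : 'I_m -> 'rV[R]_m),
    [/\ forall j, 0 <= w j, forall j, S (s j) & v = \sum_j w j *: s j].
Proof.
move=> [s0 Ss0]; elim=> [|a s u a0 Ss _ [w [t [w0 St ->]]]].
  exists (fun=> 0), (fun=> s0); split=> //.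
  by rewrite big1// => j _; rewrite scale0r.
pose w1 j := if unlift ord0 j is Some k then w k else a.
pose t1 j := if unlift ord0 j is Some k then t k else s.
have [|i [w' [w'0 w'E]]] := conic_exchange w1 t1.
  by move=> j; rewrite /w1; case: unlift.
exists w', (t1 \o lift i); split=> // [j|].
  by rewrite /= /t1; case: unlift.
rewrite -w'E big_ord_recl /w1 /t1 unlift_none; congr (_ + _).
by apply: eq_bigr => j _; rewrite liftK.
Qed.

(** * Integrals of vector-valued functions *)

Definition integrable_row {R : realType} {d} {T : measurableType d}
    (mu : {measure set T -> \bar R}) {m} (g : T -> 'rV[R]_m) :=
  forall j, mu.-integrable [set: T] (EFin \o (fun x => g x 0 j)).

Definition row_integral {R : realType} {d} {T : measurableType d}
    (mu : {measure set T -> \bar R}) {m} (g : T -> 'rV[R]_m) : 'rV[R]_m :=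
  \row_j \int[mu]_x g x 0 j.

Lemma Rintegral_lincomb {R : realType} {d} {T : measurableType d}
    (mu : {measure set T -> \bar R}) {I : Type} (r : seq I)
    (c : I -> R) (f : I -> T -> R) :
  (forall i, mu.-integrable [set: T] (EFin \o f i)) ->
  mu.-integrable [set: T] (EFin \o (fun x => \sum_(i <- r) f i x * c i)) /\
  \int[mu]_x (\sum_(i <- r) f i x * c i) =
    \sum_(i <- r) (\int[mu]_x f i x) * c i.
Proof.
move=> fi; elim: r => [|i r [IHi IHe]].
  split; first by apply: eq_integrable (integrable0 mu _) => // x _ /=;
    rewrite big_nil.
  by under eq_Rintegral do rewrite big_nil; rewrite big_nil /Rintegral integral0.
have ici : mu.-integrable [set: T] (EFin \o (fun x => f i x * c i)).
  by apply: eq_integrable (integrableZr _ _ (fi i)).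
split.
  apply: eq_integrable (integrableD _ ici IHi) => // x _ /=.
  by rewrite big_cons EFinD.
under eq_Rintegral do rewrite big_cons.
by rewrite RintegralD// RintegralZr// IHe big_cons.
Qed.

Lemma integrable_row_mulmx {R : realType} {d} {T : measurableType d}
    (mu : {measure set T -> \bar R}) {m p} (B : 'M[R]_(m, p)) g :
  integrable_row mu g -> integrable_row mu (fun x => g x *m B).
Proof.
move=> gi j.
have [+ _] := Rintegral_lincomb mu (index_enum 'I_m) (fun k => B k j) _ gi.
by apply: eq_integrable => // x _ /=; rewrite mxE.
Qed.

Lemma row_integral_mulmx {R : realType} {d} {T : measurableType d}
    (mu : {measure set T -> \bar R}) {m p} (B : 'M[R]_(m, p)) g :
  integrable_row mu g ->
  row_integral mu (fun x => g x *m B) = row_integral mu g *m B.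
Proof.
move=> gi; apply/rowP => j; rewrite !mxE.
have [_ +] := Rintegral_lincomb mu (index_enum 'I_m) (fun k => B k j) _ gi.
under [X in _ -> _ = X]eq_bigr do rewrite mxE.
by move=> <-; apply: eq_Rintegral => x _; rewrite mxE.
Qed.

(** Almost everywhere f = |f|, so the integral of |f| is at most 0, hence is
    0. *)
Lemma negligible_Rintegral_le0 {R : realType} {d} {T : measurableType d}
    (mu : {measure set T -> \bar R}) (D : set T) (f : T -> R) :
  mu.-negligible (~` D) -> mu.-integrable [set: T] (EFin \o f) ->
  (forall x, D x -> 0 <= f x) -> \int[mu]_x f x <= 0 ->
  \int[mu]_x f x = 0 /\ mu.-negligible (~` (D `&` [set x | f x = 0])).
Proof.
move=> nD fi f0 If.
have mf := measurable_int mu fi.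
have fE : (\int[mu]_x (EFin \o f) x = \int[mu]_x `|(EFin \o f) x|)%E.
  apply: ae_eq_integral => //; first exact: measurableT_comp.
  apply: negligibleS nD => x /=; apply: contra_not => Dx _.
  by rewrite ger0_norm// f0.
have intabs : (\int[mu]_x `|(EFin \o f) x| = 0)%E.
  apply/eqP; rewrite eq_le integral_ge0 ?andbT// -fE.
  by rewrite -(fineK (integrable_fin_num measurableT fi)) lee_fin.
split.
  by rewrite /Rintegral -[X in fine X]/(\int[mu]_x (EFin \o f) x)%E fE intabs.
rewrite setCI; apply: negligibleU => //.
have [N [mN N0 fN]] := (ae_eq_integral_abs mu measurableT mf).1 intabs.
exists N; split=> // x /= fx; apply: fN => /= /(_ I) [].
exact: fx.
Qed.

(** The induction on the dimension described at the top.  The kernel of c is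
    identified with a space of smaller dimension by a matrix B whose rows form a
    basis of it: the coordinates of a vector of the kernel in this basis are
    obtained by multiplying by [pinvmx B] on the right. *)
Lemma row_integral_conic_hull {R : realType} {d} {T : measurableType d}
    (mu : {measure set T -> \bar R}) {m} (g : T -> 'rV[R]_m) (D : set T) :
  integrable_row mu g -> mu.-negligible (~` D) ->
  conic_hull (g @` D) (row_integral mu g).
Proof.
have [r le_mr] := ubnP m.
elim: r m g D le_mr => [//|r IH] m g D le_mr gi nD; apply: contrapT => nhull.
have [c [c_neq0 c_ge0 c_le0]] := cone_separation _ _ (convex_cone_hull _) nhull.
pose f x := (g x *m c) 0 0.
have fi : mu.-integrable [set: T] (EFin \o f).
  exact: (integrable_row_mulmx mu c g gi 0).
have fD x : D x -> 0 <= f x by move=> Dx; apply/c_ge0/sub_conic_hull; exists x.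
have intf : \int[mu]_x f x = (row_integral mu g *m c) 0 0.
  by rewrite -row_integral_mulmx// mxE.
pose D' := D `&` [set x | f x = 0].
have [If0 nD'] : \int[mu]_x f x = 0 /\ mu.-negligible (~` D').
  by apply: negligible_Rintegral_le0 => //; rewrite intf.
have Ic0 : row_integral mu g *m c = 0.
  by apply/rowP => j; rewrite ord1 -intf If0 mxE.
pose B := row_base (kermx c).
have kerB p (M : 'M[R]_(p, m)) : M *m c = 0 -> M *m pinvmx B *m B = M.
  by move=> Mc; apply: mulmxKpV; rewrite eq_row_base; apply/sub_kermxP.
have rankB : (\rank (kermx c) < r)%N.
  rewrite mxrank_ker; apply: leq_trans (_ : m <= r)%N => //.
  have c_rank : (0 < \rank c)%N by rewrite lt0n mxrank_eq0.
  by rewrite ltn_subrL c_rank (leq_trans c_rank (rank_leq_row c)).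
have hull' := IH _ _ D' rankB (integrable_row_mulmx mu (pinvmx B) g gi) nD'.
apply: nhull; rewrite -(kerB _ _ Ic0) -row_integral_mulmx//.
apply: conic_hull_mulmx hull' => _ [x [Dx fx] <-]; exists x => //.
rewrite kerB//; apply/rowP => j; rewrite ord1 [RHS]mxE; exact: fx.
Qed.

(** * Quadrature formulas *)

Lemma fun_dim_scale {T : Type} {F : fieldType} (V : set (T -> F)) n (a : F) f :
  fun_dim V n -> V f -> V (fun x => a * f x).
Proof.
move=> [b [_ ->]] [c ->]; exists (fun i => a * c i).
apply/funext => x; rewrite !fct_sumE mulr_sumr.
by apply: eq_bigr => i _; exact: mulrA.
Qed.

Lemma real_quadrature {R : realType} {d} {T : measurableType d}
    (mu : {measure set T -> \bar R}) (W : set (T -> R)) N :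
  (forall g, W g -> mu.-integrable [set: T] (EFin \o g)) -> fun_dim W N ->
  exists (x : 'I_N -> T) (w : 'I_N -> R), (forall j, 0 <= w j) /\
    forall g, W g -> \int[mu]_x g x = \sum_j w j * g (x j).
Proof.
move=> Wi [b [_ WE]]; pose g x : 'rV[R]_N := \row_i b i x.
have bi i : mu.-integrable [set: T] (EFin \o b i).
  apply: Wi; rewrite WE; exists (fun j => (j == i)%:R).
  rewrite (bigD1 i)//= eqxx scale1r big1 ?addr0// => j /negPf ->.
  by rewrite scale0r.
have gi : integrable_row mu g.
  by move=> i; apply: eq_integrable (bi i) => // x _ /=; rewrite mxE.
have nT : mu.-negligible (~` [set: T]) by rewrite setCT; exact: negligible_set0.
have g_neq0 : g @` [set: T] !=set0 by exists (g point), point.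
have [w [s [w0 sg Iw]]] :=
  conic_caratheodory _ _ g_neq0 (row_integral_conic_hull mu g _ gi nT).
have /choice[x xs] : forall j, exists x, g x = s j.
  by move=> j; have [x _ <-] := sg j; exists x.
exists x, w; split=> // h; rewrite WE => -[c ->].
have hE y : (\sum_i c i *: b i) y = \sum_i b i y * c i.
  by rewrite fct_sumE; apply: eq_bigr => i _; exact: mulrC.
under eq_Rintegral do rewrite hE; rewrite (Rintegral_lincomb mu _ c b bi).2.
under [RHS]eq_bigr do rewrite hE mulr_sumr.
rewrite exchange_big; apply: eq_bigr => i _ /=.
have -> : \int[mu]_y b i y = \sum_j w j * b i (x j).
  transitivity (row_integral mu g 0 i).
    by rewrite mxE; apply: eq_Rintegral => y _; rewrite mxE.
  by rewrite Iw summxE; apply: eq_bigr => j _; rewrite mxE -xs mxE.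
by rewrite mulr_suml; apply: eq_bigr => j _; rewrite mulrA.
Qed.

Lemma complex_integrable_Re {R : realType} {d} {T : measurableType d}
    (mu : {measure set T -> \bar R}) (f : T -> R[i]) :
  complex_integrable mu f ->
  mu.-integrable [set: T] (EFin \o (fun x => complex.Re (f x))).
Proof.
move=> [mRe mIm foo]; apply/integrableP; split; first exact/measurable_EFinP.
have normE x : ComplexField.Normc.normc (f x) =
    Num.sqrt (complex.Re (f x) ^+ 2 + complex.Im (f x) ^+ 2).
  by case: (f x).
apply: le_lt_trans foo; apply: ge0_le_integral => //.
- by apply: measurableT_comp => //; exact/measurable_EFinP.
- apply/measurable_EFinP; under eq_fun do rewrite normE.
  apply: (measurableT_comp (continuous_measurable_fun (@sqrt_continuous R))).
  by apply: measurable_funD; exact: measurable_funX.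
- move=> x _; rewrite normE lee_fin -sqrtr_sqr ler_wsqrtr// lerDl.
  exact: sqr_ge0.
Qed.

Theorem theorem1p1 (R : realType) (d : measure_display) (T : measurableType d)
    (mu : {measure set T -> \bar R}) (k : scalars)
    (V : set (T -> scalar_field R k)) (n N : nat)
    (V_L1 : V `<=` L1fun mu (k := k))
    (dimV : fun_dim V n) (effdimV : eff_dim V N) :
  exists (x : 'I_N -> T) (w : 'I_N -> R),
    (forall j, 0 <= w j) /\
    (forall f, V f ->
       scalar_integral mu f = \sum_(j < N) scalar_of_real k (w j) * f (x j)).
Proof.
have ReV_int g : Re_space V g -> mu.-integrable [set: T] (EFin \o g).
  move=> [f /V_L1 + <-]; clear.
  by case: k f => f //; exact: complex_integrable_Re.
have [x [w [w0 quad]]] := real_quadrature mu _ N ReV_int effdimV.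
exists x, w; split=> // f Vf.
have quadRe h : V h -> \int[mu]_y scalar_Re (h y) =
    \sum_j w j * scalar_Re (h (x j)).
  by move=> Vh; apply: (quad (@scalar_Re R k \o h)); exists h.
clear V_L1 effdimV ReV_int quad; case: k V f dimV Vf quadRe => V f dimV Vf quadRe.
  exact: quadRe.
(* The formula for Im f is the formula for Re (- i f). *)
have Vif := fun_dim_scale V n (- 'i%C) f dimV Vf.
have Re_ni (z : R[i]) : complex.Re (- 'i%C * z) = complex.Im z.
  by case: z => a b /=; rewrite !(mul0r, oppr0, mulN1r, opprK, add0r, sub0r).
rewrite /= /complex_integral (quadRe f Vf).
have -> : \int[mu]_y complex.Im (f y) = \sum_j w j * complex.Im (f (x j)).
  have := quadRe _ Vif; under eq_Rintegral do rewrite /= Re_ni.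
  by move=> ->; apply: eq_bigr => j _; rewrite /= Re_ni.
have ReIm_sum (F : 'I_N -> R[i]) :
    \sum_j F j = ((\sum_j complex.Re (F j)) +i* (\sum_j complex.Im (F j)))%C.
  by apply/eqP; rewrite eq_complex /= !raddf_sum /= !eqxx.
rewrite ReIm_sum; congr (_ +i* _)%C; apply: eq_bigr => j _;
  by case: (f (x j)) => a b /=; rewrite mul0r ?subr0 ?addr0.
Qed.
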